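(* Equip $\mathcal T_{ш}(\{\prec_\mu,\succ_\mu\})$ (the set of shuffle tree monomials) with the leaf-lexicographic-path order such that $\succ_\mu$ is greater than $\prec_\mu$. Then the set of relations $\mathrm{DSu}(R_{Lie})=R_{Pre\text{-}Lie}$ of the pre-Lie operad, namely the set consisting of $$\begin{aligned} \mathrm{DSu}_1(R_{Lie})&=\prec_\mu(\prec_\mu(1,2),3)-\prec_\mu(1,\prec_\mu(2,3))-\prec_\mu(1,\succ_\mu(2,3))-\prec_\mu(\prec_\mu(1,3),2),\\ \mathrm{DSu}_2(R_{Lie})&=\prec_\mu(\succ_\mu(1,2),3)-\succ_\mu(1,\prec_\mu(2,3))-\succ_\mu(\succ_\mu(1,3),2)-\succ_\mu(\prec_\mu(1,3),2),\\ \mathrm{DSu}_3(R_{Lie})&=\succ_\mu(\succ_\mu(1,2),3)+\succ_\mu(\prec_\mu(1,2),3)-\succ_\mu(1,\succ_\mu(2,3))-\prec_\mu(\succ_\mu(1,3),2), \end{aligned}$$ is a Gröbner-Shirshov basis in the free shuffle operad $\mathbf k\mathcal T_{ш}(\{\prec_\mu,\succ_\mu\})$.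
   Context: $\mathbf k$ is a field. For a set $\mathcal V$ of binary generators, a tree monomial is a planar rooted binary tree with vertices decorated by $\mathcal V$ and leaves labelled bijectively by $1,\dots,n$ (the trivial tree $|$ is included). Each edge is labelled by the minimum of the leaf labels above it; the tree is a shuffle tree monomial if at every vertex the input labels increase from left to right. $\mathcal T_{ш}(\mathcal V)$ denotes the set of shuffle tree monomials; $\mathbf k\mathcal T_{ш}(\mathcal V)$ is the free shuffle operad on $\mathcal V$. Trees are written functionally, e.g. $\alpha(\beta(1,3),2)$ has root $\alpha$ with left child $\beta$ (having leaves $1,3$) and right input the leaf $2$. The relations come from the Lie relation $R_{Lie}=\mu(\mu(1,2),3)-\mu(1,\mu(2,3))-\mu(\mu(1,3),2)$, $\mu=-\mu^{(12)}$, by the disuccessor: for a leaf $x$, $\mathrm{DSu}_x(t)$ replaces $\mu$ at each vertex on the path from the root to leaf $x$ by $\prec_\mu$ if the path turns left there and by $\succ_\mu$ if it turns right, and replaces $\mu$ at every other vertex by $\prec_\mu+\succ_\mu$. Here $\prec_\mu=-\succ_\mu^{(12)}$, and with $\bullet=\prec_\mu$ these are the relations of the operad of right pre-Lie algebras, $(x\bullet y)\bullet z-x\bullet(y\bullet z)=(x\bullet z)\bullet y-x\bullet(z\bullet y)$. Leaf-lexicographic-path order on $\mathcal T_{ш}(\mathcal V)$, $\mathcal V$ well-ordered: first compare the sequences of leaf labels read from left to right in the planar tree, in reverse degree-lexicographic order: the longer sequence is larger, and for equal length the sequence having the smaller entry at the first position where they differ is larger (so $123>132$). If these are equal, compare path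 sequences, i.e. the sequences, indexed by leaf labels $1,2,\dots$, of words of vertex decorations along the path from the root to that leaf; these are compared word by word (first differing word decides), words being compared degree-lexicographically. $\bar f$ denotes the leading monomial of $f$. Gröbner-Shirshov basis: a $\star$-tree $q$ of arity type $n$ is a shuffle tree having exactly one vertex decorated by an extra symbol $\star_n$ with $n$ inputs (all other vertices decorated by $\mathcal V$); for a shuffle tree $u$ with $n$ leaves, $q|_u$ is obtained by replacing that vertex by $u$, the $k$-th input from the left of the $\star_n$-vertex being attached at the leaf of $u$ labelled $k$ (extended linearly in $u$). $a\circ_i b$ denotes a shuffle composition: graft the root of $b$ on leaf $i$ of $a$ and relabel leaves so that the result is a shuffle tree and the relative orders of the labels of $b$, and of the labels of $a$ with $i$ replaced by the minimum of the labels of $b$, are preserved. For monic $f,g$: (i) if there are shuffle trees $u,v,w$ with $w=\bar f\circ_i u=v\circ_j\bar g$ and $\max\{|V(\bar f)|,|V(\bar g)|\}<|V(w)|<|V(\bar f)|+|V(\bar g)|$ ($|V(\cdot)|$ is the number of vertices), then $(f,g)_w:=f\circ_i u-v\circ_j g$ (same shuffle compositions) is an intersection composition; (ii) if $w=\bar f=q|_{\bar g}$ for a $\star$-tree $q$, then $(f,g)_w:=f-q|_g$ is an including composition. A composition $(f,g)_w$ is trivial modulo $(S,w)$ if $(f,g)_w=\sum_i c_i q_i|_{s_i}$ (finite sum) with $c_i\in\mathbf k\setminus\{0\}$, $s_i\in S$, $q_i$ a $\star$-tree and $q_i|_{\overline{s_i}}<w$. A set $S$ of monic polynomials is a Gröbner-Shirshov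 basis if, for all $f,g\in S$, all intersection and including compositions $(f,g)_w$ are trivial modulo $(S,w)$. *)

(* Defs.v *)
From HB Require Import structures.
From mathcomp Require Import all_boot all_algebra.
From mathcomp Require Import finmap.
From mathcomp.multinomials Require Import monalg.

Set Implicit Arguments.
Unset Strict Implicit.
Unset Printing Implicit Defensive.

Import GRing.Theory.
Local Open Scope ring_scope.

(** * Shuffle tree monomials *)

(* [tree V]: planar binary trees with arbitrary [nat] labels on the leaves;
   the shuffle tree monomials are singled out by [is_shuffle] below. *)
Inductive tree (V : Type) : Type :=
| Leaf of nat
| Node of V & tree V & tree V.

Arguments Leaf {V} n%_N.
Arguments Node {V} v l%_N r%_N.
Coercion Leaf : nat >-> tree.

Fixpoint tree_encode V (t : tree V) : GenTree.tree (V + nat) :=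
  match t with
  | Leaf n => GenTree.Leaf (inr n)
  | Node v l r =>
      GenTree.Node 0 [:: GenTree.Leaf (inl v); tree_encode l; tree_encode r]
  end.

Fixpoint tree_decode V (t : GenTree.tree (V + nat)) : option (tree V) :=
  match t with
  | GenTree.Leaf (inr n) => Some (Leaf n)
  | GenTree.Node _ [:: GenTree.Leaf (inl v); l; r] =>
      if (tree_decode l, tree_decode r) is (Some l', Some r')
      then Some (Node v l' r') else None
  | _ => None
  end.

Lemma tree_encodeK V : pcancel (@tree_encode V) (@tree_decode V).
Proof. by elim=> [n|v l IHl r IHr] //=; rewrite IHl IHr. Qed.

HB.instance Definition _ (V : choiceType) :=
  Choice.copy (tree V) (pcan_type (@tree_encodeK V)).

Section Trees.
Context {V : Type}.
Implicit Types (t u : tree V) (s : seq nat).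

Fixpoint leaves t : seq nat :=
  match t with Leaf n => [:: n] | Node _ l r => leaves l ++ leaves r end.

Definition arity t : nat := size (leaves t).

Fixpoint nvert t : nat :=
  match t with Leaf _ => 0%N | Node _ l r => (nvert l + nvert r).+1 end.

Definition min_label s : nat := foldr minn (head 0%N s) s.

Fixpoint increasing t : bool :=
  match t with
  | Leaf _ => true
  | Node _ l r => [&& increasing l, increasing r &
                      (min_label (leaves l) < min_label (leaves r))%N]
  end.

Definition is_shuffle t : bool :=
  perm_eq (leaves t) (iota 1 (arity t)) && increasing t.

Fixpoint subst_leaves (h : nat -> tree V) t : tree V :=
  match t with
  | Leaf n => h n
  | Node v l r => Node v (subst_leaves h l) (subst_leaves h r)
  end.

(** ** Shuffle compositions *)

(* The labels of [a] (with [i] replaced by the minimum of the new labels of [b],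
   which is [psi 1]) are relabelled by [phi], those of [b] by [psi]; both maps
   are increasing and the new labels are 1, ..., n + m - 1.  The condition only
   depends on the arities n of [a] and m of [b], so the same (phi, psi) can be
   used for every monomial of a polynomial. *)
Definition shuffle_relabelling (n m i : nat) (phi psi : nat -> nat) : Prop :=
  [/\ i \in iota 1 n,
      {in iota 1 n &, {homo phi : x y / (x < y)%N}},
      {in iota 1 m &, {homo psi : x y / (x < y)%N}},
      phi i = psi 1%N &
      perm_eq ([seq phi x | x <- rem i (iota 1 n)] ++
               [seq psi y | y <- iota 1 m]) (iota 1 (n + m - 1))].

Definition graft (i : nat) (phi psi : nat -> nat) (a b : tree V) : tree V :=
  subst_leaves (fun x => if x == i
                         then subst_leaves (fun y => Leaf (psi y)) b
                         else Leaf (phi x)) a.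

(** ** Star trees *)

(* A binary tree with exactly one vertex [Star ts] decorated by the extra
   symbol, whose inputs from left to right are the trees [ts]. *)
Inductive startree : Type :=
| Star of seq (tree V)
| StarL of V & startree & tree V
| StarR of V & tree V & startree.

Implicit Types q : startree.

Fixpoint star_leaves q : seq nat :=
  match q with
  | Star ts => flatten [seq leaves t | t <- ts]
  | StarL _ l r => star_leaves l ++ leaves r
  | StarR _ l r => leaves l ++ star_leaves r
  end.

Fixpoint star_arity q : nat :=
  match q with
  | Star ts => size ts
  | StarL _ l _ => star_arity l
  | StarR _ _ r => star_arity r
  end.

Fixpoint star_increasing q : bool :=
  match q with
  | Star ts => [&& (0 < size ts)%N, all increasing ts &
                   sorted ltn [seq min_label (leaves t) | t <- ts]]
  | StarL _ l r => [&& star_increasing l, increasing r &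
                       (min_label (star_leaves l) < min_label (leaves r))%N]
  | StarR _ l r => [&& increasing l, star_increasing r &
                       (min_label (leaves l) < min_label (star_leaves r))%N]
  end.

Definition star_is_shuffle q : bool :=
  perm_eq (star_leaves q) (iota 1 (size (star_leaves q))) && star_increasing q.

(* q|_u, meaningful when [arity u = star_arity q]: the k-th input of the star
   vertex is attached at the leaf of [u] labelled k. *)
Fixpoint star_subst q u : tree V :=
  match q with
  | Star ts => subst_leaves (fun k => nth (Leaf 0) ts k.-1) u
  | StarL v l r => Node v (star_subst l u) r
  | StarR v l r => Node v l (star_subst r u)
  end.

End Trees.

Arguments startree V : clear implicits.

(** * The leaf-lexicographic-path order *)

Fixpoint lex_lt (T : eqType) (lt : rel T) (s1 s2 : seq T) : bool :=
  match s1, s2 with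
  | x :: s1', y :: s2' => lt x y || (x == y) && lex_lt lt s1' s2'
  | [::], _ :: _ => true
  | _, [::] => false
  end.

Definition deglex_lt (T : eqType) (lt : rel T) (s1 s2 : seq T) : bool :=
  (size s1 < size s2)%N || (size s1 == size s2) && lex_lt lt s1 s2.

Fixpoint path_word V (x : nat) (t : tree V) : seq V :=
  match t with
  | Leaf _ => [::]
  | Node v l r => v :: (if x \in leaves l then path_word x l else path_word x r)
  end.

Definition path_seq V (t : tree V) : seq (seq V) :=
  [seq path_word x t | x <- iota 1 (arity t)].

(* Leaf entries are compared by [>], so that 132 < 123. *)
Definition llp_lt (V : eqType) (ltV : rel V) (t1 t2 : tree V) : bool :=
  deglex_lt (fun a b => b < a)%N (leaves t1) (leaves t2) ||
  (leaves t1 == leaves t2) &&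
    lex_lt (deglex_lt ltV) (path_seq t1) (path_seq t2).

(** * Polynomials and Groebner-Shirshov bases in the free shuffle operad *)

Definition lin_ext (k : fieldType) (V : choiceType) (M : lmodType k)
    (h : tree V -> M) (f : {malg k[tree V]}) : M :=
  \sum_(t <- msupp f) f@_t *: h t.

Section GroebnerShirshov.
Context {k : fieldType} {V : choiceType}.
Variable lt : rel (tree V).
Implicit Types (f g s h : {malg k[tree V]}) (t u v w : tree V).
Implicit Types (q : startree V) (S : {malg k[tree V]} -> Prop).

(* The component of arity n of the free shuffle operad. *)
Definition in_free_operad (n : nat) f : Prop :=
  {in msupp f, forall t, is_shuffle t /\ arity t = n}.

Definition leading f t : Prop :=
  t \in msupp f /\ {in msupp f, forall t', t' != t -> lt t' t}.

Definition monic f : Prop := exists2 t, leading f t & f@_t = 1.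

Definition graft_poly_l i phi psi f u : {malg k[tree V]} :=
  lin_ext (fun t => << graft i phi psi t u >>) f.

Definition graft_poly_r j phi psi v g : {malg k[tree V]} :=
  lin_ext (fun t => << graft j phi psi v t >>) g.

Definition star_subst_poly q s : {malg k[tree V]} :=
  lin_ext (fun t => << star_subst q t >>) s.

(* [intersection_composition f g w h]: (f, g)_w = h, and similarly below. *)
Definition intersection_composition f g w h : Prop :=
  exists (tf tg u v : tree V) (i j : nat) (phi psi phi' psi' : nat -> nat),
  [/\ leading f tf /\ leading g tg,
      [/\ is_shuffle u, is_shuffle v & is_shuffle w],
      shuffle_relabelling (arity tf) (arity u) i phi psi /\
        w = graft i phi psi tf u,
      shuffle_relabelling (arity v) (arity tg) j phi' psi' /\
        w = graft j phi' psi' v tg &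
      (maxn (nvert tf) (nvert tg) < nvert w < nvert tf + nvert tg)%N /\
        h = graft_poly_l i phi psi f u - graft_poly_r j phi' psi' v g].

Definition including_composition f g w h : Prop :=
  exists (tg : tree V) (q : startree V),
  [/\ leading f w, leading g tg,
      star_is_shuffle q /\ star_arity q = arity tg,
      w = star_subst q tg &
      h = f - star_subst_poly q g].

Definition trivial_modulo S w h : Prop :=
  exists (m : nat) (c : 'I_m -> k) (q : 'I_m -> startree V)
         (s : 'I_m -> {malg k[tree V]}),
  (forall i, [/\ c i != 0, S (s i), star_is_shuffle (q i) &
     exists t, [/\ leading (s i) t, star_arity (q i) = arity t &
                   lt (star_subst (q i) t) w]]) /\
  h = \sum_(i < m) c i *: star_subst_poly (q i) (s i).

Definition GS_basis S : Prop :=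
  (forall f, S f -> (exists n, in_free_operad n f) /\ monic f) /\
  (forall f g w h, S f -> S g ->
     intersection_composition f g w h \/ including_composition f g w h ->
     trivial_modulo S w h).

End GroebnerShirshov.

(** * The disuccessor of the Lie relation *)

Inductive prelie_gen : Type := Prec | Succ.

Definition bool_of_gen (a : prelie_gen) : bool :=
  if a is Succ then true else false.
Definition gen_of_bool (b : bool) : prelie_gen := if b then Succ else Prec.
Lemma bool_of_genK : cancel bool_of_gen gen_of_bool.
Proof. by case. Qed.

HB.instance Definition _ := Choice.copy prelie_gen (can_type bool_of_genK).

Definition gen_lt : rel prelie_gen := fun a b => (a == Prec) && (b == Succ).

(* The Lie operad has the single shuffle generator mu. *)
Notation mu := tt (only parsing).

(* Multilinear expansion of the tree with every vertex decorated by
   Prec + Succ, as the list of its monomials. *)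
Fixpoint expand (t : tree unit) : seq (tree prelie_gen) :=
  match t with
  | Leaf n => [:: Leaf n]
  | Node _ l r =>
      [seq Node Prec a b | a <- expand l, b <- expand r] ++
      [seq Node Succ a b | a <- expand l, b <- expand r]
  end.

(* Monomials of DSu_x(t): Prec or Succ along the path to the leaf x, and the
   expansion of Prec + Succ at all other vertices. *)
Fixpoint dsu_monomials (x : nat) (t : tree unit) : seq (tree prelie_gen) :=
  match t with
  | Leaf n => [:: Leaf n]
  | Node _ l r =>
      if x \in leaves l
      then [seq Node Prec a b | a <- dsu_monomials x l, b <- expand r]
      else [seq Node Succ a b | a <- expand l, b <- dsu_monomials x r]
  end.

Definition DSu (k : fieldType) (x : nat) (f : {malg k[tree unit]}) :
    {malg k[tree prelie_gen]} :=
  lin_ext (fun t => \sum_(s <- dsu_monomials x t) << s >>) f.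

Definition R_Lie (k : fieldType) : {malg k[tree unit]} :=
  << Node mu (Node mu 1 2) 3 >> - << Node mu 1 (Node mu 2 3) >>
  - << Node mu (Node mu 1 3) 2 >>.

(* The set DSu(R_Lie) = { DSu_x(R_Lie) : x a leaf }, that is R_PreLie. *)
Definition R_PreLie (k : fieldType) (f : {malg k[tree prelie_gen]}) : Prop :=
  exists2 x : nat, x \in iota 1 3 & f = DSu x (R_Lie k).

(* Main.v *)
(* The leading monomials are the left combs x(y(1,2),3) with (x, y) one of
   (Prec, Prec), (Prec, Succ), (Succ, Succ).  Two of them overlap only in a left
   comb x(y(z(1,2),3),4), whose labelling is forced, so there are four
   intersection compositions; each reduces to 0 in 13 steps with coefficients
   1 and -1.  An including composition inserts a leading monomial into one with
   as many vertices, hence has f = g and vanishes. *)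

Require Import Defs.
From HB Require Import structures.
From mathcomp Require Import all_boot all_algebra.
From mathcomp Require Import finmap.
From mathcomp.multinomials Require Import monalg.

Set Implicit Arguments.
Unset Strict Implicit.
Unset Printing Implicit Defensive.

Import GRing.Theory.
Local Open Scope ring_scope.

(** * Vertex counts and small shuffle trees *)

Section TreeFacts.
Context {V : Type}.
Implicit Types (t u a b : tree V) (q : startree V).

Lemma eq_in_subst_leaves (h h' : nat -> tree V) t :
  {in leaves t, h =1 h'} -> subst_leaves h t = subst_leaves h' t.
Proof.
elim: t => [n|v l IHl r IHr] /= hh'; first by apply: hh'; rewrite inE.
by rewrite IHl ?IHr // => x xt; apply: hh'; rewrite mem_cat xt ?orbT.
Qed.

Lemma nvert_subst_leaves (h : nat -> tree V) t :
  nvert (subst_leaves h t) = (nvert t + \sum_(x <- leaves t) nvert (h x))%N.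
Proof.
elim: t => [n|v l IHl r IHr] /=; first by rewrite big_seq1.
by rewrite IHl IHr big_cat addSn addnACA.
Qed.

(** As the labels of [a] are distinct, exactly one leaf is replaced by [b]; every other leaf stays a
    leaf. *)
Lemma nvert_graft i phi psi a b : uniq (leaves a) -> i \in leaves a ->
  nvert (graft i phi psi a b) = (nvert a + nvert b)%N.
Proof.
move=> ua ia; rewrite nvert_subst_leaves (bigD1_seq i) //= eqxx.
rewrite nvert_subst_leaves !big1 ?addn0 // => x.
by case: eqP.
Qed.

Lemma eq_in_graft i phi psi phi' psi' a b :
    {in leaves a, phi =1 phi'} -> {in leaves b, psi =1 psi'} ->
  graft i phi psi a b = graft i phi' psi' a b.
Proof.
move=> phiE psiE; apply: eq_in_subst_leaves => x xa.
case: eqP => _; last by rewrite phiE.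
by apply: eq_in_subst_leaves => y /psiE ->.
Qed.

(** All vertices of [u] survive in the result. For including compositions this rules out star trees
    having a vertex besides the star. *)
Lemma leq_nvert_star_subst q u : (nvert u <= nvert (star_subst q u))%N.
Proof.
elim: q => [ts|v l IHl r|v l r IHr] /=.
- by rewrite nvert_subst_leaves leq_addr.
- by apply: leq_trans IHl _; rewrite leqW // leq_addr.
- by apply: leq_trans IHr _; rewrite leqW // leq_addl.
Qed.

Lemma nvert0P t : nvert t = 0%N -> exists n, t = Leaf n.
Proof. by case: t => [n|//] _; exists n. Qed.

Lemma shuffle_nvert1 t : is_shuffle t -> nvert t = 1%N ->
  exists v, t = Node v 1 2.
Proof.
case: t => //= v l r + [/eqP]; rewrite addn_eq0 => + /andP[/eqP l0 /eqP r0].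
have [m ->] := nvert0P l0; have [n ->] := nvert0P r0.
rewrite /is_shuffle /= /min_label /= !minnn => /andP[p lt_mn].
(* A strictly increasing sequence is determined by its set of members. *)
have [-> ->] : [:: m; n] = [:: 1; 2]%N.
  by apply: (irr_sorted_eq ltn_trans ltnn) => //=; [rewrite lt_mn|apply: perm_mem].
by exists v.
Qed.

End TreeFacts.

(** * Polynomials as signed lists of monomials *)

Section SignedSums.
Context {k : fieldType} {V : choiceType}.
Implicit Types (l : seq (bool * tree V)) (t : tree V).

(* The sign bit [true] stands for the coefficient [-1]. *)
Definition spoly l : {malg k[tree V]} := \sum_(p <- l) (-1) ^+ p.1 *: << p.2 >>.

(** Summing over any finite set that contains the support gives [f], [g] and [f + g] a common index
    set, whence additivity. *)
Lemma lin_extE (M : lmodType k) (h : tree V -> M) (f : {malg k[tree V]})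
    (d : {fset tree V}) :
  (msupp f `<=` d)%fset -> lin_ext h f = \sum_(t <- d) f@_t *: h t.
Proof.
move=> fd; rewrite /lin_ext (big_fset_incl _ fd) // => t _.
by move=> /mcoeff_outdom ->; rewrite scale0r.
Qed.

Lemma lin_extD (M : lmodType k) (h : tree V -> M) (f g : {malg k[tree V]}) :
  lin_ext h (f + g) = lin_ext h f + lin_ext h g.
Proof.
rewrite (lin_extE h (msuppD_le f g)) (lin_extE h (fsubsetUl _ (msupp g))).
rewrite (lin_extE h (fsubsetUr (msupp f) _)) -big_split /=.
by apply: eq_bigr => t _; rewrite mcoeffD scalerDl.
Qed.

Lemma lin_extZ (M : lmodType k) (h : tree V -> M) c (f : {malg k[tree V]}) :
  lin_ext h (c *: f) = c *: lin_ext h f.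
Proof.
rewrite (lin_extE h (msuppZ_le c f)) scaler_sumr.
by apply: eq_bigr => t _; rewrite mcoeffZ scalerA.
Qed.

Lemma lin_extU (M : lmodType k) (h : tree V -> M) t : lin_ext h << t >> = h t.
Proof.
by rewrite (lin_extE h (msuppU_le (x := 1))) big_seq_fset1 mcoeffUU scale1r.
Qed.

Lemma lin_ext_spoly (M : lmodType k) (h : tree V -> M) l :
  lin_ext h (spoly l) = \sum_(p <- l) (-1) ^+ p.1 *: h p.2.
Proof.
rewrite /spoly; elim: l => [|p l IHl].
  by rewrite !big_nil /lin_ext msupp0 big_seq_fset0.
by rewrite !big_cons lin_extD lin_extZ lin_extU IHl.
Qed.

Lemma spoly_seq1 t : spoly [:: (true, t)] = - << t >>.
Proof. by rewrite /spoly big_seq1 scaleN1r. Qed.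

Lemma spoly_pos t l : spoly ((false, t) :: l) = << t >> + spoly l.
Proof. by rewrite /spoly big_cons scale1r. Qed.

Lemma spoly_neg1 t l : spoly ((true, t) :: l) = - << t >> + spoly l.
Proof. by rewrite /spoly big_cons scaleN1r. Qed.

(** The one-element rule comes first, so that no empty sum is left over. It has sign -1 because
    every list expanded with these rules ends in a negative term. *)
Definition spolyE := (spoly_seq1, spoly_pos, spoly_neg1).

Definition negl l := [seq (~~ p.1, p.2) | p <- l].

Lemma spoly_cat l1 l2 : spoly (l1 ++ l2) = spoly l1 + spoly l2.
Proof. exact: big_cat. Qed.

Lemma spoly_neg l : spoly (negl l) = - spoly l.
Proof.
by rewrite /spoly big_map -sumrN; apply: eq_bigr => -[[] t] _;
   rewrite /= ?expr0 ?expr1 scale1r scaleN1r ?opprK.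
Qed.

Lemma perm_spoly l1 l2 : perm_eq l1 l2 -> spoly l1 = spoly l2.
Proof. exact: perm_big. Qed.

(* Cancellation is tested on monomials, hence holds in every characteristic. *)
Lemma spoly_eq0 l :
  perm_eq [seq p.2 | p <- l & ~~ p.1] [seq p.2 | p <- l & p.1] -> spoly l = 0.
Proof.
move=> pn; rewrite /spoly (bigID (fun p => p.1)) /=.
rewrite (eq_bigr (fun p => - << p.2 >>)) => [|p ->]; last by rewrite scaleN1r.
rewrite [X in _ + X](eq_bigr (fun p => << p.2 >>)) => [|p /negbTE ->]; last first.
  by rewrite scale1r.
rewrite sumrN -[X in - X]big_filter -[X in _ + X]big_filter.
rewrite -!(big_map (fun p => p.2) xpredT (fun t => << t >>)).
by rewrite (perm_big _ pn) addNr.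
Qed.

Lemma mcoeff_spoly l t :
  (spoly l)@_t = \sum_(p <- l) (-1) ^+ p.1 * (p.2 == t)%:R.
Proof.
rewrite /spoly raddf_sum; apply: eq_bigr => p _.
by rewrite /= mcoeffZ mcoeffU.
Qed.

Lemma mcoeff_spoly_out l t : t \notin [seq p.2 | p <- l] -> (spoly l)@_t = 0.
Proof.
move=> tl; rewrite mcoeff_spoly big_seq big1 // => p pl.
by case: eqP => [pt|_]; [rewrite -pt map_f in tl | rewrite mulr0].
Qed.

Lemma msupp_spoly l : {subset msupp (spoly l) <= [seq p.2 | p <- l]}.
Proof.
move=> t; rewrite -mcoeff_neq0; apply: contraR => /mcoeff_spoly_out ->.
exact: eqxx.
Qed.

Variable lt : rel (tree V).

(** As [lt] is an arbitrary relation here, asymmetry is tested term by term: it keeps [t] out of [l]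
    and makes the leading monomial unique. *)
Definition dominates t l := all (fun p => lt p.2 t && ~~ lt t p.2) l.

Lemma mcoeff_spoly_head t l : dominates t l ->
  (spoly ((false, t) :: l))@_t = 1.
Proof.
move=> /allP dom; rewrite mcoeff_spoly big_cons eqxx expr0 mul1r.
rewrite -mcoeff_spoly mcoeff_spoly_out ?addr0 //.
by apply/mapP => -[p /dom /andP[lt1 lt2] tp]; rewrite tp in lt1 lt2; rewrite lt1 in lt2.
Qed.

Lemma leading_spoly t l : dominates t l -> leading lt (spoly ((false, t) :: l)) t.
Proof.
move=> dom; split; first by rewrite -mcoeff_neq0 mcoeff_spoly_head ?oner_neq0.
move=> t' /msupp_spoly; rewrite inE => /orP[/eqP ->|/mapP[p pl ->] _].
  by rewrite eqxx.
by have /andP[] := allP dom p pl.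
Qed.

Lemma leading_spoly_eq t l t' : dominates t l ->
  leading lt (spoly ((false, t) :: l)) t' -> t' = t.
Proof.
move=> dom [/msupp_spoly]; rewrite inE => /orP[/eqP //|/mapP[p pl ->] max_p].
apply/eqP; apply: contraT; rewrite eq_sym => /(max_p t).
have [t_supp _] := leading_spoly dom; move=> /(_ t_supp).
by have /andP[_ /negbTE ->] := allP dom p pl.
Qed.

End SignedSums.

(** * The three relations and the reductions of their overlaps *)

(* The relations are indexed by the leaf [x] of [DSu x]; junk for [x] outside 1, 2, 3. *)
Definition root_gen (x : nat) : prelie_gen := if x is 3 then Succ else Prec.
Definition child_gen (x : nat) : prelie_gen := if x is 1 then Prec else Succ.
Definition lead (x : nat) : tree prelie_gen :=
  Node (root_gen x) (Node (child_gen x) 1 2) 3.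

Definition lower_terms (x : nat) : seq (bool * tree prelie_gen) :=
  match x with
  | 1 => [:: (true, Node Prec 1 (Node Prec 2 3));
             (true, Node Prec 1 (Node Succ 2 3));
             (true, Node Prec (Node Prec 1 3) 2)]
  | 2 => [:: (true, Node Succ 1 (Node Prec 2 3));
             (true, Node Succ (Node Succ 1 3) 2);
             (true, Node Succ (Node Prec 1 3) 2)]
  | _ => [:: (false, Node Succ (Node Prec 1 2) 3);
             (true, Node Succ 1 (Node Succ 2 3));
             (true, Node Prec (Node Succ 1 3) 2)]
  end.

Definition terms x := (false, lead x) :: lower_terms x.

Lemma terms_shuffle x :
  all (fun p => is_shuffle p.2 && (arity p.2 == 3)) (terms x).
Proof. by case: x => [|[|[|[|x]]]]; vm_compute. Qed.

(* An entry [(b, q, z)] stands for [(-1) ^ b q|_s] with [s] the z-th relation; the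
   entries are the successive steps of the reduction of the S-polynomial. *)
Definition certificate (x y : nat) :
    seq (bool * startree prelie_gen * nat) :=
  match x, y with
  | 1, 1 => [::
      (false, Star [:: Leaf 1; Node Succ 2 3; Leaf 4], 1);
      (false, Star [:: Leaf 1; Node Prec 2 3; Leaf 4], 1);
      (true, Star [:: Leaf 1; Leaf 2; Node Succ 3 4], 1);
      (true, Star [:: Leaf 1; Leaf 2; Node Prec 3 4], 1);
      (false, StarR Prec (Leaf 1) (Star [:: Leaf 2; Leaf 3; Leaf 4]), 3);
      (false, StarR Prec (Leaf 1) (Star [:: Leaf 2; Leaf 3; Leaf 4]), 2);
      (false, StarR Prec (Leaf 1) (Star [:: Leaf 2; Leaf 3; Leaf 4]), 1);
      (true, StarL Prec (Star [:: Leaf 1; Leaf 2; Leaf 4]) (Leaf 3), 1);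
      (true, Star [:: Leaf 1; Node Succ 2 4; Leaf 3], 1);
      (true, Star [:: Leaf 1; Node Prec 2 4; Leaf 3], 1);
      (false, Star [:: Node Prec 1 3; Leaf 2; Leaf 4], 1);
      (false, StarL Prec (Star [:: Leaf 1; Leaf 3; Leaf 4]) (Leaf 2), 1);
      (true, Star [:: Node Prec 1 4; Leaf 2; Leaf 3], 1)]
  | 1, 2 => [::
      (false, Star [:: Leaf 1; Node Prec 2 3; Leaf 4], 2);
      (true, Star [:: Leaf 1; Leaf 2; Node Succ 3 4], 2);
      (true, Star [:: Leaf 1; Leaf 2; Node Prec 3 4], 2);
      (false, StarR Succ (Leaf 1) (Star [:: Leaf 2; Leaf 3; Leaf 4]), 1);
      (true, StarL Prec (Star [:: Leaf 1; Leaf 2; Leaf 4]) (Leaf 3), 2);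
      (true, Star [:: Leaf 1; Node Prec 2 4; Leaf 3], 2);
      (false, Star [:: Node Succ 1 3; Leaf 2; Leaf 4], 2);
      (false, Star [:: Node Prec 1 3; Leaf 2; Leaf 4], 2);
      (false, StarL Succ (Star [:: Leaf 1; Leaf 3; Leaf 4]) (Leaf 2), 3);
      (false, StarL Succ (Star [:: Leaf 1; Leaf 3; Leaf 4]) (Leaf 2), 2);
      (false, StarL Succ (Star [:: Leaf 1; Leaf 3; Leaf 4]) (Leaf 2), 1);
      (true, Star [:: Node Succ 1 4; Leaf 2; Leaf 3], 2);
      (true, Star [:: Node Prec 1 4; Leaf 2; Leaf 3], 2)]
  | 2, 3 => [::
      (true, Star [:: Node Prec 1 2; Leaf 3; Leaf 4], 2);
      (true, Star [:: Leaf 1; Leaf 2; Node Prec 3 4], 3);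
      (false, Star [:: Leaf 1; Node Succ 2 3; Leaf 4], 2);
      (false, StarR Succ (Leaf 1) (Star [:: Leaf 2; Leaf 3; Leaf 4]), 2);
      (true, StarL Succ (Star [:: Leaf 1; Leaf 2; Leaf 4]) (Leaf 3), 3);
      (true, StarL Succ (Star [:: Leaf 1; Leaf 2; Leaf 4]) (Leaf 3), 2);
      (true, StarL Succ (Star [:: Leaf 1; Leaf 2; Leaf 4]) (Leaf 3), 1);
      (true, Star [:: Leaf 1; Node Succ 2 4; Leaf 3], 3);
      (true, Star [:: Leaf 1; Node Prec 2 4; Leaf 3], 3);
      (false, Star [:: Node Succ 1 3; Leaf 2; Leaf 4], 1);
      (false, StarL Prec (Star [:: Leaf 1; Leaf 3; Leaf 4]) (Leaf 2), 2);
      (true, Star [:: Node Succ 1 4; Leaf 2; Leaf 3], 3);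
      (true, Star [:: Node Prec 1 4; Leaf 2; Leaf 3], 3)]
  | 3, 3 => [::
      (true, Star [:: Node Prec 1 2; Leaf 3; Leaf 4], 3);
      (false, StarL Succ (Star [:: Leaf 1; Leaf 2; Leaf 3]) (Leaf 4), 2);
      (false, StarL Succ (Star [:: Leaf 1; Leaf 2; Leaf 3]) (Leaf 4), 1);
      (false, Star [:: Leaf 1; Node Succ 2 3; Leaf 4], 3);
      (false, Star [:: Leaf 1; Node Prec 2 3; Leaf 4], 3);
      (true, Star [:: Leaf 1; Leaf 2; Node Succ 3 4], 3);
      (false, StarR Succ (Leaf 1) (Star [:: Leaf 2; Leaf 3; Leaf 4]), 3);
      (true, StarL Prec (Star [:: Leaf 1; Leaf 2; Leaf 4]) (Leaf 3), 3);
      (true, Star [:: Leaf 1; Node Succ 2 4; Leaf 3], 2);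
      (false, Star [:: Node Succ 1 3; Leaf 2; Leaf 4], 3);
      (false, Star [:: Node Prec 1 3; Leaf 2; Leaf 4], 3);
      (false, StarL Prec (Star [:: Leaf 1; Leaf 3; Leaf 4]) (Leaf 2), 3);
      (true, Star [:: Node Succ 1 4; Leaf 2; Leaf 3], 1)]
  | _, _ => [::]
  end.

(* The two relabellings that produce the overlap [x(y(z(1,2),3),4)], as a
   composition of the first relation and as a composition with the second. *)
Definition relabel_tf : nat -> nat := bump 2.
Definition relabel_v (x : nat) : nat := if x == 1 then 1 else 4.

Definition overlap x y : tree prelie_gen :=
  Node (root_gen x) (Node (child_gen x) (Node (child_gen y) 1 2) 3) 4.

(** The S-polynomial of the relations [x] and [y], with fixed relabellings so that it can be
    computed. *)
Definition overlap_terms x y : seq (bool * tree prelie_gen) :=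
  [seq (p.1, graft 1 relabel_tf id p.2 (Node (child_gen y) 1 2)) | p <- terms x] ++
  negl [seq (p.1, graft 1 relabel_v id (Node (root_gen x) 1 2) p.2) | p <- terms y].

Definition certificate_terms (L : seq (bool * startree prelie_gen * nat)) :=
  flatten [seq [seq (c.1.1 (+) p.1, star_subst c.1.2 p.2) | p <- terms c.2] | c <- L].

(** A decidable form of the side conditions in [trivial_modulo], for coefficients that are signs. *)
Definition certifies (w : tree prelie_gen)
    (L : seq (bool * startree prelie_gen * nat)) :=
  all (fun c => [&& star_is_shuffle c.1.2, star_arity c.1.2 == 3, c.2 \in iota 1 3 &
                 llp_lt gen_lt (star_subst c.1.2 (lead c.2)) w]) L.

Definition cancels (l1 l2 : seq (bool * tree prelie_gen)) :=
  let l := l1 ++ negl l2 in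
  perm_eq [seq p.2 | p <- l & ~~ p.1] [seq p.2 | p <- l & p.1].

Definition composable := [:: (1, 1); (1, 2); (2, 3); (3, 3)]%N.

(** A finite check on signs and monomials alone, so that one computation serves every field. *)
Lemma certificates_ok : all (fun xy => let: (x, y) := xy in
   certifies (overlap x y) (certificate x y) &&
   cancels (overlap_terms x y) (certificate_terms (certificate x y))) composable.
Proof. by vm_compute. Qed.

Lemma composableP x y : x \in iota 1 3 -> y \in iota 1 3 ->
  child_gen x = root_gen y -> (x, y) \in composable.
Proof.
by rewrite !inE => /or3P[]/eqP-> /or3P[]/eqP->.
Qed.

(** * Overlaps of two left combs *)

(* Besides the shape, the labelling is forced: [psi 1 < psi 2 < phi 2 < phi 3]
   exhaust [1, ..., 4]. *)
Lemma comb_overlap (V : Type) (r c r' c' : V) (u v : tree V)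
    i j (phi psi phi' psi' : nat -> nat) :
    let tf := Node r (Node c 1 2) 3 in let tg := Node r' (Node c' 1 2) 3 in
    is_shuffle u -> is_shuffle v ->
    shuffle_relabelling (arity tf) (arity u) i phi psi ->
    shuffle_relabelling (arity v) (arity tg) j phi' psi' ->
    graft i phi psi tf u = graft j phi' psi' v tg ->
    (2 < nvert (graft i phi psi tf u) < 4)%N ->
  [/\ c = r', u = Node c' 1 2 & v = Node r 1 2] /\
  [/\ i = 1%N, j = 1%N, {in iota 1 3, phi =1 relabel_tf} /\ {in iota 1 2, psi =1 id} &
      {in iota 1 2, phi' =1 relabel_v} /\ {in iota 1 3, psi' =1 id}].
Proof.
move=> tf tg shu shv [itf phi_lt psi_lt phi_i perm_w] [jv _ psi'_lt phi'_j _] E.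
have nE : nvert (graft i phi psi tf u) = (2 + nvert u)%N by apply: nvert_graft.
have uv : perm_eq (leaves v) (iota 1 (arity v)) by case/andP: shv.
have nE' : nvert (graft i phi psi tf u) = (nvert v + 2)%N.
  rewrite E; apply: nvert_graft; last by rewrite (perm_mem uv).
  by rewrite (perm_uniq uv) iota_uniq.
(* The bounds leave exactly three vertices in the overlap, hence one in [u] and one in [v]. *)
rewrite nE => n3; have nu : nvert u = 1%N by move: n3; case: (nvert u) => [|[|n]].
have nv : nvert v = 1%N by apply/eqP; rewrite -(eqn_add2r 2) -nE' nE nu.
have [z uE] := shuffle_nvert1 shu nu; have [z' vE] := shuffle_nvert1 shv nv.
move: itf jv phi_lt psi_lt psi'_lt perm_w phi_i phi'_j E.
(* Of the six choices of [(i, j)], only [(1, 1)] gives both sides the same shape. *)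
rewrite {}uE {}vE /tf /tg /arity /= !inE => /or3P[]/eqP-> /orP[]/eqP-> //=.
rewrite /graft /= => phi_lt psi_lt psi'_lt perm_w phi1 phi'1.
case=> -> -> -> p1 p2 p3 p4.
have psi12 : (psi 1 < psi 2)%N by apply: psi_lt.
(* The first relabelling does not compare these two labels; the second does, since [psi 2] is
   [psi' 2] and [phi 2] is [psi' 3]. *)
have psi23 : (psi 2 < phi 2)%N by rewrite p2 p3; apply: psi'_lt.
have phi23 : (phi 2 < phi 3)%N by apply: phi_lt.
have [q1 q2 q3 q4] : [:: psi 1; psi 2; phi 2; phi 3]%N = [:: 1; 2; 3; 4]%N.
  apply: (irr_sorted_eq ltn_trans ltnn) => //=; first by rewrite psi12 psi23 phi23.
  apply/perm_mem/(perm_trans _ perm_w).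
  exact: (permEl (perm_catC [:: psi 1; psi 2]%N [:: phi 2; phi 3]%N)).
do 2!split=> //; split=> x; rewrite !inE.
- by move=> /or3P[]/eqP->; rewrite ?phi1 ?q1 ?q3 ?q4.
- by move=> /orP[]/eqP->; rewrite ?q1 ?q2.
- by move=> /orP[]/eqP->; rewrite ?phi'1 -?p1 -?p4 ?q1 ?q4.
- by move=> /or3P[]/eqP->; rewrite -?p1 -?p2 -?p3 ?q1 ?q2 ?q3.
Qed.

(** * Triviality of the compositions *)

Section Compositions.
Variable k : fieldType.

Lemma lin_ext_spolyU (V W : choiceType) (h : tree V -> tree W) l :
  lin_ext (fun t => << h t >>) (spoly l) =
  spoly [seq (p.1, h p.2) | p <- l] :> {malg k[tree W]}.
Proof. by rewrite lin_ext_spoly /spoly big_map. Qed.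

Lemma R_LieE : R_Lie k = spoly
  [:: (false, Node tt (Node tt 1 2) 3); (true, Node tt 1 (Node tt 2 3));
      (true, Node tt (Node tt 1 3) 2)].
Proof. by rewrite /R_Lie !spolyE addrA. Qed.

Lemma DSu_spoly x l : DSu x (spoly l : {malg k[tree unit]}) =
  spoly (flatten [seq [seq (p.1, s) | s <- dsu_monomials x p.2] | p <- l]).
Proof.
rewrite /DSu lin_ext_spoly /spoly big_flatten big_map.
by apply: eq_bigr => p _; rewrite big_map scaler_sumr.
Qed.

(** Expanding the three Lie monomials yields exactly the signed monomials in [terms x], up to order
    and without cancellation. *)
Lemma DSuE x : x \in iota 1 3 -> DSu x (R_Lie k) = spoly (terms x).
Proof.
move=> x13; rewrite R_LieE DSu_spoly; apply: perm_spoly; move: x x13.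
by apply/allP; vm_compute.
Qed.

Lemma dominates_lead x : x \in iota 1 3 ->
  dominates (llp_lt gen_lt) (lead x) (lower_terms x).
Proof. by move: x; apply/allP; vm_compute. Qed.

Lemma leading_terms x : x \in iota 1 3 ->
  leading (llp_lt gen_lt) (spoly (terms x) : {malg k[tree prelie_gen]}) (lead x).
Proof. by move=> x13; apply/leading_spoly/dominates_lead. Qed.

Lemma spoly_cancels l1 l2 : cancels l1 l2 ->
  spoly l1 = spoly l2 :> {malg k[tree prelie_gen]}.
Proof.
move=> /spoly_eq0 => /(_ k) /eqP; rewrite spoly_cat spoly_neg subr_eq0.
by move=> /eqP.
Qed.

(** The entries of [L] become the families required by [trivial_modulo]: [certifies] gives the side
    conditions and [cancels] the equality. *)
Lemma trivial_certificate w l (L : seq (bool * startree prelie_gen * nat)) :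
    certifies w L -> cancels l (certificate_terms L) ->
  trivial_modulo (llp_lt gen_lt) (@R_PreLie k) w (spoly l).
Proof.
rewrite /certifies -[L in all _ L]/(tval (in_tuple L)).
move=> /all_tnthP okL /spoly_cancels ->.
exists (size L), (fun i => (-1) ^+ (tnth (in_tuple L) i).1.1),
  (fun i => (tnth (in_tuple L) i).1.2),
  (fun i => spoly (terms (tnth (in_tuple L) i).2)).
split=> [i|]; last first.
  rewrite -(big_tnth _ _ L xpredT (fun c =>
    (-1) ^+ c.1.1 *: star_subst_poly c.1.2 (spoly (terms c.2)))).
  rewrite /spoly big_flatten big_map; apply: eq_bigr => c _.
  rewrite big_map /star_subst_poly lin_ext_spoly scaler_sumr.
  by apply: eq_bigr => p _; rewrite scalerA signr_addb.
have /and4P[shq /eqP arq x13 ltq] := okL i.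
split=> //; first by rewrite signr_eq0.
  by exists (tnth (in_tuple L) i).2; rewrite ?DSuE.
exists (lead (tnth (in_tuple L) i).2); split=> //.
exact: leading_terms.
Qed.

(** Uniqueness of the leading monomial identifies the one named in a composition with [lead x]. *)
Lemma R_PreLieP f t : @R_PreLie k f -> leading (llp_lt gen_lt) f t ->
  exists x, [/\ x \in iota 1 3, f = spoly (terms x) & t = lead x].
Proof.
move=> [x x13 ->]; rewrite DSuE // => lead_t; exists x; split=> //.
exact: leading_spoly_eq (dominates_lead x13) lead_t.
Qed.

Lemma intersection_trivial f g w h : @R_PreLie k f -> @R_PreLie k g ->
  intersection_composition (llp_lt gen_lt) f g w h ->
  trivial_modulo (llp_lt gen_lt) (@R_PreLie k) w h.
Proof.
move=> Sf Sg [tf [tg [u [v [i [j [phi [psi [phi' [psi' []]]]]]]]]]].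
move=> [/(R_PreLieP Sf)[x [x13 -> ->]] /(R_PreLieP Sg)[y [y13 -> ->]]].
move=> [shu shv _] [rel_f ->] [rel_g E] [n_w ->].
have [[cr uE vE] [i1 j1 [phiE psiE] [phi'E psi'E]]] :=
  comb_overlap shu shv rel_f rel_g E n_w.
subst u v i j.
have w_E : graft 1 phi psi (lead x) (Node (child_gen y) 1 2) = overlap x y.
  by rewrite /graft /= !phiE ?psiE ?inE.
rewrite w_E /graft_poly_l /graft_poly_r !lin_ext_spolyU -spoly_neg -spoly_cat.
have /andP[ok_w ok_l] := allP certificates_ok _ (composableP x13 y13 cr).
(* The given relabellings are known only on actual labels. Every term of the relation has the same
   labels as its leading monomial, so the whole composition is the standard one. *)
have fE : [seq (p.1, graft 1 phi psi p.2 (Node (child_gen y) 1 2)) | p <- terms x] =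
    [seq (p.1, graft 1 relabel_tf id p.2 (Node (child_gen y) 1 2)) | p <- terms x].
  apply/eq_in_map => p /(allP (terms_shuffle x)).
  case/andP=> /andP[/perm_mem lp _] /eqP p3; rewrite p3 in lp; congr (_, _).
  by apply: eq_in_graft => n; [rewrite lp; apply: phiE | apply: psiE].
have gE : [seq (p.1, graft 1 phi' psi' (Node (root_gen x) 1 2) p.2) | p <- terms y] =
    [seq (p.1, graft 1 relabel_v id (Node (root_gen x) 1 2) p.2) | p <- terms y].
  apply/eq_in_map => p /(allP (terms_shuffle y)).
  case/andP=> /andP[/perm_mem lp _] /eqP p3; rewrite p3 in lp; congr (_, _).
  by apply: eq_in_graft => n; [apply: phi'E | rewrite lp; apply: psi'E].
rewrite fE gE.
exact: trivial_certificate ok_w ok_l.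
Qed.

Lemma including_trivial f g w h : @R_PreLie k f -> @R_PreLie k g ->
  including_composition (llp_lt gen_lt) f g w h ->
  trivial_modulo (llp_lt gen_lt) (@R_PreLie k) w h.
Proof.
move=> Sf Sg [tg [q []]].
move=> /(R_PreLieP Sf)[x [x13 -> ->]] /(R_PreLieP Sg)[y [y13 -> ->]].
move=> [_]; rewrite /star_subst_poly lin_ext_spolyU => + + ->.
(* With a vertex outside the star, the two vertices of [lead y] would lie in a proper subtree of
   [lead x], which has at most one vertex. *)
case: q => [ts|z l r|z l r] /=; last 2 first.
- by move=> _ [_ E _]; have := leq_nvert_star_subst l (lead y); rewrite -E.
- by move=> _ [_ _ E]; have := leq_nvert_star_subst r (lead y); rewrite -E.
case: ts => [|a [|b [|c []]]] //= _ [xy xy' <- <- <-].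
(* The pair of root and child generators determines the relation. *)
have -> : y = x.
  by move: x13 y13 xy xy'; rewrite !inE => /or3P[]/eqP-> /or3P[]/eqP->.
(* A star with inputs 1, 2, 3 acts as the identity on the relation, so the difference cancels and
   the empty certificate suffices. *)
rewrite -spoly_neg -spoly_cat; apply: (trivial_certificate (L := [::])) => //.
by move: x13; rewrite !inE => /or3P[]/eqP->; vm_compute.
Qed.

End Compositions.

(** * Explicit relations and the Gröbner-Shirshov property *)

Theorem theorem3p5 (k : fieldType) :
  [/\ DSu 1 (R_Lie k) =
        << Node Prec (Node Prec 1 2) 3 >> - << Node Prec 1 (Node Prec 2 3) >>
        - << Node Prec 1 (Node Succ 2 3) >> - << Node Prec (Node Prec 1 3) 2 >>,
      DSu 2 (R_Lie k) =
        << Node Prec (Node Succ 1 2) 3 >> - << Node Succ 1 (Node Prec 2 3) >>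
        - << Node Succ (Node Succ 1 3) 2 >> - << Node Succ (Node Prec 1 3) 2 >>,
      DSu 3 (R_Lie k) =
        << Node Succ (Node Succ 1 2) 3 >> + << Node Succ (Node Prec 1 2) 3 >>
        - << Node Succ 1 (Node Succ 2 3) >> - << Node Prec (Node Succ 1 3) 2 >> &
      GS_basis (llp_lt gen_lt) (@R_PreLie k)].
Proof.
split; [by rewrite (DSuE k (x := 1) isT) [terms _]/= !spolyE 2![LHS]addrA
      | by rewrite (DSuE k (x := 2) isT) [terms _]/= !spolyE 2![LHS]addrA
      | by rewrite (DSuE k (x := 3) isT) [terms _]/= !spolyE 2![LHS]addrA |].
split=> [f [x x13 ->]|f g w h Sf Sg [|]].
- rewrite DSuE //; split.
    exists 3%N => t /msupp_spoly /mapP[p /(allP (terms_shuffle x))].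
    by move=> /andP[shp /eqP p3] ->.
  exists (lead x); first exact: leading_terms.
  exact: mcoeff_spoly_head (dominates_lead x13).
- exact: intersection_trivial.
- exact: including_trivial.
Qed.
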